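(* Let $K$ be a field of characteristic zero. There exists an integer $N$ such that for every integer $n\ge N$ there exists an integer $D=D(n)$ such that for every $d\ge D$ the following holds: if $R = K[x_0,\ldots,x_n]$ and $I = (x_0^{d},\ldots,x_n^d,L^d)$, where $L\in R$ is a general linear form, then the ring $R/I$ fails the weak Lefschetz property.
   Context: $R$ has its standard grading. A graded Artinian $K$-algebra $A$ has the weak Lefschetz property (WLP) if there is a linear form $\ell$ such that, for every integer $j$, the multiplication map $\ell\colon [A]_{j-1}\to[A]_j$ has maximal rank (is injective or surjective); otherwise $A$ fails the WLP. A statement holds for a general linear form $L$ if it holds for all $L$ in some nonempty Zariski-open subset of $[R]_1$. *)

(* Defs.v *)
From HB Require Import structures.
From mathcomp Require Import all_boot all_order all_algebra.
From mathcomp Require Import generic_quotient ring_quotient.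
From mathcomp.classical Require Import boolp.
From mathcomp.multinomials Require Import mpoly.

Set Implicit Arguments.
Unset Strict Implicit.
Unset Printing Implicit Defensive.

Import GRing.Theory.
Local Open Scope ring_scope.
Local Open Scope quotient_scope.

Section GeneratedIdeal.
Variables (R : comPzRingType) (gs : seq R).

Definition gen_ideal : {pred R} := fun f =>
  asbool (exists h : nat -> R, f = \sum_(i < size gs) h i * gs`_i).

Lemma gen_idealP f :
  reflect (exists h : nat -> R, f = \sum_(i < size gs) h i * gs`_i)
          (f \in gen_ideal).
Proof. exact: asboolP. Qed.

Lemma gen_ideal_zmod_closed : zmod_closed gen_ideal.
Proof.
split; first by apply/gen_idealP; exists (fun=> 0); rewrite big1 // => i _; rewrite mul0r.
move=> _ _ /gen_idealP[h ->] /gen_idealP[k ->]; apply/gen_idealP.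
exists (fun i => h i - k i); rewrite -sumrB.
by apply: eq_bigr => i _; rewrite mulrBl.
Qed.

HB.instance Definition _ :=
  GRing.isZmodClosed.Build R gen_ideal gen_ideal_zmod_closed.

Lemma gen_idealMr a u : u \in gen_ideal -> a * u \in gen_ideal.
Proof.
move=> /gen_idealP[h ->]; apply/gen_idealP; exists (fun i => a * h i).
by rewrite mulr_sumr; apply: eq_bigr => i _; rewrite mulrA.
Qed.

(* The library puts a ring structure on [{ideal_quot _}] only for proper
   ideals; it is rebuilt here on the quotient group so that R/(gs) is also
   defined when (gs) is the unit ideal. *)
Definition quot_ring := Quotient.quot gen_ideal.
HB.instance Definition _ := Choice.on quot_ring.
HB.instance Definition _ := GRing.Zmodule.on quot_ring.

Definition to_quot (f : R) : quot_ring := \pi_(Quotient.quot gen_ideal) f.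
Definition quot_mul (x y : quot_ring) : quot_ring := to_quot (repr x * repr y).

Lemma to_quot_eq f g : to_quot f = to_quot g <-> f - g \in gen_ideal.
Proof. by rewrite Quotient.idealrBE; split=> [/eqP|/eqP]. Qed.

Lemma to_quotK x : to_quot (repr x) = x.
Proof. exact: (@reprK _ (Quotient.quot gen_ideal) x). Qed.

Lemma to_quotD : {morph to_quot : f g / f + g}.
Proof. exact: Quotient.pi_add. Qed.

Lemma to_quotM : {morph to_quot : f g / f * g >-> quot_mul f g}.
Proof.
move=> f g; apply/to_quot_eq.
set f' := repr (to_quot f); set g' := repr (to_quot g).
have If : f - f' \in gen_ideal by apply/to_quot_eq; rewrite to_quotK.
have Ig : g - g' \in gen_ideal by apply/to_quot_eq; rewrite to_quotK.
have -> : f * g - f' * g' = g * (f - f') + f' * (g - g').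
  by rewrite !mulrBr addrA [g * f]mulrC [g * f']mulrC subrK.
by rewrite rpredD ?gen_idealMr.
Qed.

Fact quot_mulA : associative quot_mul.
Proof.
move=> x y z; rewrite -[x]to_quotK -[y]to_quotK -[z]to_quotK.
by rewrite -!to_quotM mulrA.
Qed.

Fact quot_mulC : commutative quot_mul.
Proof. by move=> x y; rewrite /quot_mul mulrC. Qed.

Fact quot_mul1 : left_id (to_quot 1) quot_mul.
Proof. by move=> x; rewrite -[x]to_quotK -to_quotM mul1r. Qed.

Fact quot_mulDl : left_distributive quot_mul +%R.
Proof.
move=> x y z; rewrite -[x]to_quotK -[y]to_quotK -[z]to_quotK.
by rewrite -to_quotD -!to_quotM mulrDl to_quotD.
Qed.

HB.instance Definition _ := GRing.Zmodule_isComPzRing.Build quot_ring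
  quot_mulA quot_mulC quot_mul1 quot_mulDl.

End GeneratedIdeal.

(* [gr j a] reads "a belongs to the homogeneous component [A]_j". *)
Definition WLP (A : comPzRingType) (gr : int -> A -> Prop) : Prop :=
  exists2 l : A, gr 1 l & forall j : int,
    (forall a b, gr (j - 1) a -> gr (j - 1) b -> l * a = l * b -> a = b) \/
    (forall b, gr j b -> exists2 a, gr (j - 1) a & l * a = b).

Section PolynomialRing.
Variables (K : fieldType) (n : nat).

Definition mpoly_grading (j : int) (f : {mpoly K[n]}) : Prop :=
  match j with Posz k => f \is k.-homog | Negz _ => f = 0 end.

Definition quot_grading (gs : seq {mpoly K[n]}) (j : int) (a : quot_ring gs)
  : Prop := exists2 f, mpoly_grading j f & a = to_quot gs f.

(* [dhomog n K 1] is the space [R]_1, coordinatized by the coefficients of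
   the variables; open sets are complements of zero loci of arbitrary
   families of polynomials in these coordinates. *)
Definition zariski_open (U : dhomog n K 1 -> Prop) : Prop :=
  exists S : {mpoly K[n]} -> Prop, forall L : dhomog n K 1,
    U L <-> exists2 p, S p & p.@[fun i => (L : {mpoly K[n]})@_U_(i)] != 0.

Definition for_general_linear_form (P : {mpoly K[n]} -> Prop) : Prop :=
  exists U : dhomog n K 1 -> Prop,
    [/\ zariski_open U, exists L, U L & forall L, U L -> P L].

Definition power_gens (d : nat) (L : {mpoly K[n]}) : seq {mpoly K[n]} :=
  rcons [seq 'X_i ^+ d | i <- enum 'I_n] (L ^+ d).

End PolynomialRing.

(* Main.v *)
Require Import Defs.
From mathcomp Require Import all_boot all_order all_algebra.
From mathcomp Require Import perm ring zify.
From mathcomp.classical Require Import boolp.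
From mathcomp.multinomials Require Import ssrcomplements mpoly.

(** Write A = R/I and let l be a linear form. Multiplication by l fails to be
surjective onto [A]_j as soon as there is a form F of degree j (in the dual
variables, on which R acts by differentiation) killed by l and of degree less
than d in the direction of each x_i and of L. The n + 2 points dual to the x_i
and to L, taken modulo l, lie on a rational normal curve, and F is a product of
equations of secant varieties of that curve, or of cones over them: these are
Hankel determinants, linear in each of the directions. For n even one has to
take degree j about (n/2 + 1/2 - 1/(2n + 2)) d, slightly less than for n odd.

On the other hand, by the strong Lefschetz property of R/(x_0^d, ..., x_n^d)
(proved with an sl2 action), injectivity of the multiplication by l into [A]_j
would force surjectivity if a second difference of the coefficients of
((1 - z^d)/(1 - z))^(n+2) is at most zero at z^j. Log-concavity of these
coefficients shows that it is. *)

Set Implicit Arguments.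
Unset Strict Implicit.
Unset Printing Implicit Defensive.

Import Order.TTheory GRing.Theory Num.Theory.
Local Open Scope ring_scope.

(** * Contraction by differential operators *)

Section Contraction.
Variables (K : fieldType) (n : nat).
Implicit Types (f g L F G : {mpoly K[n]}) (m : 'X_{1..n}).

(** The variables of [f] act on [F] as partial derivatives, without division by factorials. *)
Definition contract f F := \sum_(m <- msupp f) f@_m *: F^`M[m].

Lemma contract_widen k f F : (msize f <= k)%N ->
  contract f F = \sum_(m : 'X_{1..n < k}) f@_m *: F^`M[m].
Proof.
move=> lefk; rewrite /contract (big_mksub 'X_{1..n < k}) /=; first last.
- by move=> m /msize_mdeg_lt/leq_trans/(_ lefk).
- exact: msupp_uniq.
rewrite big_rmcond //= => m; rewrite -mcoeff_eq0 => /eqP ->.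
by rewrite scale0r.
Qed.

Lemma contractD f g F : contract (f + g) F = contract f F + contract g F.
Proof.
set k := maxn (msize (f + g)) (maxn (msize f) (msize g)).
rewrite !(@contract_widen k) ?leq_max ?leqnn ?orbT // -big_split /=.
by apply: eq_bigr => m _; rewrite mcoeffD scalerDl.
Qed.

Lemma contractZ c f F : contract (c *: f) F = c *: contract f F.
Proof.
set k := maxn (msize (c *: f)) (msize f).
rewrite !(@contract_widen k) ?leq_max ?leqnn ?orbT // scaler_sumr.
by apply: eq_bigr => m _; rewrite mcoeffZ scalerA.
Qed.

Lemma contract0 F : contract 0 F = 0.
Proof. by rewrite /contract msupp0 big_nil. Qed.

Lemma contract_sum (I : Type) (r : seq I) (P : pred I) (f : I -> {mpoly K[n]}) F :
  contract (\sum_(i <- r | P i) f i) F = \sum_(i <- r | P i) contract (f i) F.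
Proof.
elim: r => [|i r IH]; first by rewrite !big_nil contract0.
by rewrite !big_cons; case: (P i); rewrite ?contractD IH.
Qed.

Lemma contractX m F : contract 'X_[m] F = F^`M[m].
Proof. by rewrite /contract msuppX big_seq1 mcoeffX eqxx scale1r. Qed.

Lemma contractDr f F G : contract f (F + G) = contract f F + contract f G.
Proof.
by rewrite /contract -big_split /=; apply: eq_bigr => m _; rewrite -scalerDr linearD.
Qed.

Lemma contractZr c f F : contract f (c *: F) = c *: contract f F.
Proof.
rewrite /contract scaler_sumr; apply: eq_bigr => m _.
by rewrite mderivmZ !scalerA mulrC.
Qed.

Lemma contract0r f : contract f 0 = 0.
Proof. by rewrite /contract big1 // => m _; rewrite linear0 scaler0. Qed.

Lemma contractXM m f F : contract ('X_[m] * f) F = contract f F^`M[m].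
Proof.
rewrite {1}(mpolyE f) mulr_sumr contract_sum [RHS]/contract; apply: eq_bigr => m' _.
by rewrite -scalerAr -mpolyXD contractZ contractX mderivmDm.
Qed.

Lemma contractM f g F : contract (f * g) F = contract f (contract g F).
Proof.
rewrite mulrC {1}(mpolyE g) mulr_suml contract_sum [contract g F]/contract.
transitivity (\sum_(m <- msupp g) contract f (g@_m *: F^`M[m])).
  by apply: eq_bigr => m _; rewrite -scalerAl contractZ contractXM contractZr.
elim: (msupp g) => [|m s IH]; first by rewrite !big_nil contract0r.
by rewrite !big_cons contractDr IH.
Qed.

Lemma linear_formE L : L \is 1.-homog -> L = \sum_i L@_U_(i) *: 'X_i.
Proof.
move=> L1; apply/mpolyP => m; rewrite raddf_sum /=.
have [/mdeg1P[i /eqP->]|m1] := boolP (mdeg m == 1%N).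
  rewrite (bigD1 i) //= mcoeffZ mcoeffXU eqxx mulr1 big1 ?addr0 // => i' ne.
  by rewrite mcoeffZ mcoeffXU (negPf ne) mulr0.
rewrite (dhomog_nemf_coeff L1 m1) big1 // => i _.
rewrite mcoeffZ mcoeffX; case: eqP => [e|_]; last by rewrite mulr0.
by rewrite -e mdeg1 eqxx in m1.
Qed.

Lemma contract_linear L F : L \is 1.-homog ->
  contract L F = \sum_i L@_U_(i) *: F^`M(i).
Proof.
move=> /linear_formE {1}->; rewrite contract_sum; apply: eq_bigr => i _.
by rewrite contractZ contractX mderivmU1m.
Qed.

Lemma contract_linearM L F G : L \is 1.-homog ->
  contract L (F * G) = contract L F * G + F * contract L G.
Proof.
move=> L1; rewrite !contract_linear // mulr_suml mulr_sumr -big_split /=.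
by apply: eq_bigr => i _; rewrite mderivM scalerDr -scalerAl -scalerAr.
Qed.

(* [F] has degree at most [a] in the direction of the vector dual to [L]. *)
Definition dir_deg_le L a F := contract (L ^+ a.+1) F = 0.

Lemma dir_deg_leW L a b F : (a <= b)%N -> dir_deg_le L a F -> dir_deg_le L b F.
Proof.
move=> leab; rewrite /dir_deg_le -(subnK leab) -addnS exprD contractM => ->.
exact: contract0r.
Qed.

Lemma dir_deg_leS L a F : dir_deg_le L a.+1 F <-> dir_deg_le L a (contract L F).
Proof. by rewrite /dir_deg_le exprSr contractM. Qed.

Lemma dir_deg_le0 L F : dir_deg_le L 0 F <-> contract L F = 0.
Proof. by rewrite /dir_deg_le expr1. Qed.

Lemma dir_deg_leD L a F G :
  dir_deg_le L a F -> dir_deg_le L a G -> dir_deg_le L a (F + G).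
Proof. by rewrite /dir_deg_le contractDr => -> ->; rewrite addr0. Qed.

Lemma dir_deg_leZ L a c F : dir_deg_le L a F -> dir_deg_le L a (c *: F).
Proof. by rewrite /dir_deg_le contractZr => ->; rewrite scaler0. Qed.

Lemma dir_deg_le_zero L a : dir_deg_le L a 0.
Proof. exact: contract0r. Qed.

Lemma dir_deg_leM L a b F G : L \is 1.-homog ->
  dir_deg_le L a F -> dir_deg_le L b G -> dir_deg_le L (a + b) (F * G).
Proof.
move=> L1; move Dk: (a + b)%N => k; elim: k => [|k IH] in a b F G Dk *.
  have [-> ->] : a = 0%N /\ b = 0%N by lia.
  rewrite !dir_deg_le0 contract_linearM // => -> ->.
  by rewrite mul0r mulr0 addr0.
move=> Fa Gb; rewrite dir_deg_leS contract_linearM //; apply: dir_deg_leD.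
  case: a Dk Fa => [|a] Dk Fa.
    by move/dir_deg_le0: Fa => ->; rewrite mul0r; apply: dir_deg_le_zero.
  by apply: (IH a b) => //; [lia | apply/dir_deg_leS].
case: b Dk Gb => [|b] Dk Gb.
  by move/dir_deg_le0: Gb => ->; rewrite mulr0; apply: dir_deg_le_zero.
by apply: (IH a b) => //; [lia | apply/dir_deg_leS].
Qed.

Lemma dir_deg_le1 L : L \is 1.-homog -> dir_deg_le L 0 1.
Proof.
move=> L1; apply/dir_deg_le0; rewrite contract_linear // big1 // => i _.
by rewrite -mpolyC1 mderivC scaler0.
Qed.

Lemma dir_deg_le_prod L (I : Type) (r : seq I) (a : I -> nat)
    (F : I -> {mpoly K[n]}) : L \is 1.-homog ->
  (forall i, dir_deg_le L (a i) (F i)) ->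
  dir_deg_le L (\sum_(i <- r) a i) (\prod_(i <- r) F i).
Proof.
move=> L1 Fa; elim: r => [|i r IH]; first by rewrite !big_nil; apply: dir_deg_le1.
by rewrite !big_cons; apply: dir_deg_leM.
Qed.

Lemma dir_deg_le_exp L a k F : L \is 1.-homog ->
  dir_deg_le L a F -> dir_deg_le L (a * k) (F ^+ k).
Proof.
move=> L1 Fa; elim: k => [|k IH]; first by rewrite muln0; apply: dir_deg_le1.
by rewrite exprS mulnS; apply: dir_deg_leM.
Qed.

Lemma dir_deg_le_det L k (o : 'I_k -> nat) (M : 'M[{mpoly K[n]}]_k) :
  L \is 1.-homog -> (forall p q, dir_deg_le L (o p) (M p q)) ->
  dir_deg_le L (\sum_p o p) (\det M).
Proof.
move=> L1 Mo; rewrite /determinant; apply: (big_ind (dir_deg_le L _)).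
- exact: dir_deg_le_zero.
- by move=> F G; apply: dir_deg_leD.
move=> s _; rewrite -signr_odd mulr_sign; case: ifP => _.
  by rewrite -scaleN1r; apply/dir_deg_leZ/dir_deg_le_prod.
exact: dir_deg_le_prod.
Qed.

Lemma dhomog_det k (M : 'M[{mpoly K[n]}]_k) :
  (forall p q, M p q \is 1.-homog) -> \det M \is k.-homog.
Proof.
move=> M1; rewrite /determinant; apply: rpred_sum => s _.
suff H : \prod_i M i (s i) \is (\sum_(i < k) 1).-homog.
  by rewrite sum1_card card_ord in H; rewrite -signr_odd mulr_sign; case: ifP; rewrite ?rpredN.
by elim/big_rec2: _ => [|i d F _ IH]; [exact: dhomog1 | exact: dhomogM].
Qed.

End Contraction.

(** * Hankel determinants *)

Section Hankel.
Variables (K : fieldType) (m : nat) (th : 'I_m -> K).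
Implicit Types (L : {mpoly K[m]}) (w : 'I_m -> K).

(** The entries are the moments of the masses [w l * 'X_l] at the nodes [th l]; the zeros of the
    determinant form a secant variety of a rational normal curve, or a cone over one. *)
Definition hankel w k : 'M[{mpoly K[m]}]_k :=
  \matrix_(p, q) \sum_l (w l * th l ^+ (p + q)) *: 'X_l.

Lemma mderivXU (i l : 'I_m) : ('X_l : {mpoly K[m]})^`M(i) = ((l == i)%:R)%:MP.
Proof.
rewrite mderivX mnm1E; case: eqVneq => [->|_]; last by rewrite scale0r mpolyC0.
have -> : (U_(i) - U_(i))%MM = 0%MM :> 'X_{1..m}.
  by apply/mnmP => k; rewrite mnmBE mnm0E subnn.
by rewrite scale1r mpolyX0.
Qed.

Lemma contract_hankel L w k p q : L \is 1.-homog ->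
  contract L (hankel w k p q) = (\sum_l w l * L@_U_(l) * th l ^+ (p + q))%:MP.
Proof.
move=> L1; rewrite mxE contract_linear // [RHS]raddf_sum /=.
under eq_bigr => i _ do rewrite (raddf_sum (mderiv i)) scaler_sumr.
rewrite exchange_big; apply: eq_bigr => l _ /=; rewrite (bigD1 l) //= big1 => [|i il].
  rewrite addr0 mderivZ mderivXU eqxx scalerA -mul_mpolyC mulr1.
  by congr (_%:MP); ring.
by rewrite mderivZ mderivXU eq_sym (negPf il) mpolyC0 !scaler0.
Qed.

Lemma hankel_deg0 L w k : L \is 1.-homog ->
  (forall t, (t.+2 <= k.*2)%N -> \sum_l w l * L@_U_(l) * th l ^+ t = 0) ->
  dir_deg_le L 0 (\det (hankel w k)).
Proof.
move=> L1 w0; suff: dir_deg_le L (\sum_(p < k) 0) (\det (hankel w k)) by rewrite big1.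
apply: dir_deg_le_det => // p q; apply/dir_deg_le0; rewrite contract_hankel //.
by rewrite w0 ?raddf0 //; move: (ltn_ord p) (ltn_ord q); lia.
Qed.

Lemma dir_deg_le_det_row L k (p0 : 'I_k) (M : 'M[{mpoly K[m]}]_k) :
  L \is 1.-homog -> (forall p q, p != p0 -> dir_deg_le L 0 (M p q)) ->
  (forall q, dir_deg_le L 1 (M p0 q)) -> dir_deg_le L 1 (\det M).
Proof.
move=> L1 M0 M1; have -> : 1%N = (\sum_(p < k) (p == p0))%N.
  rewrite (bigD1 p0) //= eqxx big1 // => p /negPf-> //.
apply: dir_deg_le_det => // p q; case: eqVneq => [->|/M0//]; exact: M1.
Qed.

Lemma hankel_entry_deg1 L w k p q : L \is 1.-homog ->
  dir_deg_le L 1 (hankel w k p q).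
Proof.
move=> L1; apply/dir_deg_leS/dir_deg_le0; rewrite contract_hankel //.
by rewrite contract_linear // big1 // => i _; rewrite mderivC scaler0.
Qed.

(** Only the moment of top order 2k - 2 can survive. It occurs in the corner alone, so contraction
    with [L] kills all rows but the last. *)
Lemma hankel_deg1 L w k : L \is 1.-homog ->
  (forall t, (t.+2 < k.*2)%N -> \sum_l w l * L@_U_(l) * th l ^+ t = 0) ->
  dir_deg_le L 1 (\det (hankel w k)).
Proof.
move=> L1; case: k => [|k] w0; first by rewrite det_mx00; apply/(dir_deg_leW (leq0n 1))/dir_deg_le1.
apply: (@dir_deg_le_det_row _ _ ord_max) => // [p q ne|q].
  apply/dir_deg_le0; rewrite contract_hankel // w0 ?raddf0 //.
  by move: ne (ltn_ord p) (ltn_ord q); rewrite -val_eqE /=; lia.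
exact: hankel_entry_deg1.
Qed.

Lemma dhomogXU i : ('X_i : {mpoly K[m]}) \is 1.-homog.
Proof. by rewrite dhomogX; apply/eqP/mdeg1. Qed.

Lemma sum_mcoeffXU i (f : 'I_m -> K) : \sum_l f l * ('X_i : {mpoly K[m]})@_U_(l) = f i.
Proof.
rewrite (bigD1 i) //= mcoeffXU eqxx mulr1 big1 ?addr0 // => l ne.
by rewrite mcoeffXU eq_sym (negPf ne) mulr0.
Qed.

Lemma hankel_deg0_var i w k : w i = 0 -> dir_deg_le 'X_i 0 (\det (hankel w k)).
Proof.
move=> wi; apply: hankel_deg0 => [|t _]; first exact: dhomogXU.
under eq_bigr => l _ do rewrite mulrAC.
by rewrite (sum_mcoeffXU i (fun l => w l * th l ^+ t)) wi mul0r.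
Qed.

(* Contracting with 'X_i leaves the rank one matrix w_i v v^T, where
   v = (1, th_i, th_i^2, ...); the row operations below clear all of its rows
   but the first. *)
Lemma hankel_deg1_var i w k : dir_deg_le 'X_i 1 (\det (hankel w k)).
Proof.
case: k => [|k]; first by rewrite det_mx00; apply/(dir_deg_leW (leq0n 1))/dir_deg_le1/dhomogXU.
pose P : 'M[{mpoly K[m]}]_k.+1 := \matrix_(p, q) ((p == q)%:R - (p == q.+1 :> nat)%:R * (th i)%:MP).
have detP : \det P = 1.
  rewrite det_trig; last first.
    apply/is_trig_mxP => p q ltpq; rewrite mxE.
    have /negPf-> : p != q by rewrite neq_ltn ltpq.
    have /negPf-> : p != q.+1 :> nat by lia.
    by rewrite mul0r subr0.
  rewrite big1 // => p _; rewrite mxE eqxx.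
  have /negPf-> : p != p.+1 :> nat by lia.
  by rewrite mul0r subr0.
rewrite -[\det _]mul1r -detP -det_mulmx.
have PE (p q : 'I_k.+1) : (P *m hankel w k.+1) p q =
    hankel w k.+1 p q - \sum_(r < k.+1 | p == r.+1 :> nat) th i *: hankel w k.+1 r q.
  rewrite mxE; under eq_bigr => r _ do rewrite mxE mulrBl.
  rewrite sumrB; congr (_ - _).
    rewrite (bigD1 p) //= eqxx mul1r big1 ?addr0 // => r ne.
    by rewrite eq_sym (negPf ne) mul0r.
  rewrite [RHS]big_mkcond; apply: eq_bigr => r _ /=.
  by case: eqP => _; rewrite ?mul1r ?mul0r ?mul_mpolyC.
have cE p q : contract 'X_i (hankel w k.+1 p q) = (w i * th i ^+ (p + q))%:MP.
  rewrite contract_hankel ?dhomogXU //; congr (_%:MP).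
  under eq_bigr => l _ do rewrite mulrAC.
  exact: (sum_mcoeffXU i (fun l => w l * th l ^+ (p + q))).
apply: (@dir_deg_le_det_row _ _ ord0) => [|p q p0|q]; rewrite ?dhomogXU //.
  apply/dir_deg_le0; rewrite PE contractDr cE -scaleN1r contractZr scaleN1r.
  have ltp : (p.-1 < k.+1)%N by move: (ltn_ord p); lia.
  have pS : p = (Ordinal ltp).+1 :> nat by move: p0; rewrite -val_eqE /=; lia.
  rewrite (big_pred1 (Ordinal ltp)) => [|r]; last first.
    by rewrite /= -val_eqE /= {1}pS eqSS eq_sym.
  rewrite contractZr cE /= {1}pS addSn exprS -mul_mpolyC -mpolyCM.
  by rewrite mulrCA subrr.
rewrite PE big_pred0 => [|r]; last by [].
by rewrite subr0; apply/hankel_entry_deg1/dhomogXU.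
Qed.

Lemma dhomog_hankel w k : \det (hankel w k) \is k.-homog.
Proof.
apply: dhomog_det => p q; rewrite mxE; apply: rpred_sum => l _.
by apply/dhomogZ/dhomogXU.
Qed.

(** At a point supported on the [k] nodes [th (s i)], with all masses equal to one, the matrix
    becomes V V^T for an invertible Vandermonde matrix V. *)
Lemma hankel_neq0 w k (s : 'I_k -> 'I_m) : injective th -> injective s ->
  (forall i, w (s i) != 0) -> \det (hankel w k) != 0.
Proof.
move=> th_inj s_inj ws; apply/eqP => det0.
pose y l := \sum_i (s i == l)%:R / w l.
pose V := Vandermonde k (\row_i th (s i)).
have VV : map_mx (meval y) (hankel w k) = V *m V^T.
  apply/matrixP => p q; rewrite !mxE raddf_sum /=.
  under eq_bigr => l _ do rewrite mevalZ mevalXU mulr_sumr.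
  rewrite exchange_big; apply: eq_bigr => i _; rewrite !mxE /=.
  rewrite (bigD1 (s i)) //= eqxx big1 => [|l ne].
    by rewrite addr0 mul1r mulrAC mulfV // mul1r exprD.
  by rewrite eq_sym (negPf ne) mul0r mulr0.
have := congr1 determinant VV.
rewrite det_map_mx det0 raddf0 det_mulmx det_tr det_Vandermonde => /esym/eqP.
rewrite mulf_eq0 orbb; apply/negP.
apply/prodf_neq0 => i _; apply/prodf_neq0 => j ltij; rewrite !mxE subr_eq0.
by apply: contraTneq ltij => /th_inj/s_inj ->; rewrite ltnn.
Qed.

End Hankel.

(** The m vectors (1, th, ..., th^(m-2)) are dependent, and no weight of a relation vanishes because
    any m - 1 of them are independent. *)
Lemma lagrange_weights (K : fieldType) (m : nat) (th : 'I_m -> K) :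
  (0 < m)%N -> injective th ->
  exists u : 'I_m -> K, (forall l, u l != 0) /\
    forall t, (t.+1 < m)%N -> \sum_l u l * th l ^+ t = 0.
Proof.
move=> m_gt0 th_inj; pose A : 'M[K]_(m, m.-1) := \matrix_(l, t) th l ^+ t.
have : kermx A != 0.
  rewrite kermx_eq0 /row_free; apply: contraTneq m_gt0 => rkA.
  by have := rank_leq_col A; rewrite rkA; lia.
case/rowV0Pn => v /sub_kermxP vA v_neq0.
have uE t : (t.+1 < m)%N -> \sum_l v 0 l * th l ^+ t = 0.
  move=> ltt; have ltt' : (t < m.-1)%N by lia.
  have /matrixP/(_ 0 (Ordinal ltt')) := vA; rewrite !mxE => {2}<-.
  by apply: eq_bigr => l _; rewrite !mxE.
exists (v 0); split=> // i; apply: contra_neq v_neq0 => vi0.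
apply/rowP => l0; rewrite mxE.
have [-> //|l0i] := eqVneq l0 i.
(* [p] has degree m - 2 and vanishes at all nodes but those of [i] and [l0]; as [v 0 i = 0], only
   the term of [l0] remains in the relation. *)
pose p := \prod_(l <- enum (~: [set i; l0])) ('X - (th l)%:P).
have size_p : (size p <= m.-1)%N.
  rewrite size_prod_XsubC -cardE cardsCs setCK cards2 eq_sym l0i card_ord /=.
  move: l0i (ltn_ord i) (ltn_ord l0); rewrite -val_eqE /=. lia.
have : \sum_l v 0 l * p.[th l] = 0.
  under eq_bigr => l _ do rewrite (horner_coef_wide _ size_p) mulr_sumr.
  rewrite exchange_big big1 // => t _.
  under eq_bigr => l _ do rewrite mulrCA.
  by rewrite -mulr_sumr uE ?mulr0 //; move: (ltn_ord t); lia.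
rewrite (bigD1 l0) //= big1 => [|l ll0].
  rewrite addr0 => /eqP; rewrite mulf_eq0 => /orP[/eqP//|].
  rewrite /p horner_prod prodf_seq_eq0 => /hasP[l].
  rewrite mem_enum !inE negb_or => /andP[_ ll0].
  by rewrite hornerXsubC subr_eq0 (inj_eq th_inj) eq_sym (negPf ll0).
have [->|li] := eqVneq l i; first by rewrite vi0 mul0r.
apply/eqP; rewrite mulf_eq0 /p horner_prod prodf_seq_eq0; apply/orP; right.
apply/hasP; exists l; first by rewrite mem_enum !inE negb_or li.
by rewrite hornerXsubC subrr eqxx.
Qed.

(** * Forms annihilated by the ideal and by a generic linear form *)

Section ApolarForm.
Variables (K : fieldType) (m : nat).
Implicit Types (l L F : {mpoly K[m]}).

(** For d > 0, contraction makes [F] a nonzero functional in degree [j] that vanishes on the ideal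
    and on the multiples of [l]: an obstruction to surjectivity. *)
Definition apolar_form d L l j F :=
  [/\ F != 0, F \is j.-homog, contract l F = 0,
      forall i, dir_deg_le 'X_i d.-1 F & dir_deg_le L d.-1 F].

(* The interpolation nodes: the curve t |-> (l_i / (t - slope i))_i, modulo the
   coefficient vector of l, is a rational normal curve that passes through the
   coordinate points and through the coefficient vector of L. *)
Definition slope L l i := L@_U_(i) / l@_U_(i).

Variables (L l : {mpoly K[m]}).
Hypotheses (L1 : L \is 1.-homog) (l1 : l \is 1.-homog).
Hypothesis l_neq0 : forall i, l@_U_(i) != 0.
Hypothesis slope_inj : injective (slope L l).

(** Dividing the Lagrange weights by the coefficients of [l] turns their relations into vanishing
    moments of [l]. The coefficients of [L] are those of [l] times the nodes, so its moments are
    shifted by one and one order of vanishing is lost. *)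
Lemma hankel_weights : (0 < m)%N -> exists w : 'I_m -> K,
  [/\ forall i, w i != 0,
      forall t, (t.+1 < m)%N -> \sum_i w i * l@_U_(i) * slope L l i ^+ t = 0 &
      forall t, (t.+2 < m)%N -> \sum_i w i * L@_U_(i) * slope L l i ^+ t = 0].
Proof.
move=> m_gt0; have [u [u_neq0 u0]] := lagrange_weights m_gt0 slope_inj.
exists (fun i => u i / l@_U_(i)); split=> [i|t ltt|t ltt].
- by rewrite mulf_neq0 ?invr_neq0.
- rewrite -[RHS](u0 t ltt); apply: eq_bigr => i _; by rewrite divfK.
- rewrite -[RHS](u0 t.+1 ltt); apply: eq_bigr => i _.
  by rewrite exprS /slope; ring.
Qed.

(** One Hankel determinant has degree zero along [l] and at most one along each variable and [L];
    its power of exponent d - 1 exhausts the allowed degrees. *)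
Lemma apolar_form_even k d : (0 < k)%N -> m = k.*2 ->
  exists F, apolar_form d L l (k * d.-1) F.
Proof.
move=> k_gt0 mk; have [|w [w_neq0 wl wL]] := hankel_weights; first by lia.
have ltkm : (k <= m)%N by lia.
exists (\det (hankel (slope L l) w k) ^+ d.-1); split.
- apply/expf_neq0/(@hankel_neq0 _ _ _ _ _ (widen_ord ltkm)) => //.
  by move=> i i' /(congr1 val)/= /val_inj.
- exact/dhomogMn/dhomog_hankel.
- apply/dir_deg_le0; apply: (@dir_deg_le_exp _ _ _ 0 d.-1) => //.
  by apply: hankel_deg0 => // t ltt; apply: wl; lia.
- move=> i; apply: (@dir_deg_leW _ _ _ (1 * d.-1)); first by rewrite mul1n.
  by apply: dir_deg_le_exp; [exact: dhomogXU | exact: hankel_deg1_var].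
- apply: (@dir_deg_leW _ _ _ (1 * d.-1)); first by rewrite mul1n.
  apply: dir_deg_le_exp => //.
  by apply: hankel_deg1 => // t ltt; apply: wL; lia.
Qed.

Lemma dhomog_prod_const (I : finType) k (G : I -> {mpoly K[m]}) :
  (forall i, G i \is k.-homog) -> \prod_i G i \is (#|I| * k).-homog.
Proof.
move=> Gk; rewrite -sum_nat_const.
by elim/big_rec2: _ => [|i e F _ IH]; [exact: dhomog1 | exact: dhomogM].
Qed.

(* Each factor [hankel (w (th - th_i)) k] is a cone with vertex the i-th
   coordinate point, [hankel w k] is a cone with vertex the point of [L]. *)
Lemma apolar_form_odd k q d : (0 < k)%N -> m = k.*2.+1 -> (m * q <= d.-1)%N ->
  exists F, apolar_form d L l ((m.+1 * k) * q) F.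
Proof.
move=> k_gt0 mk leq; have [|w [w_neq0 wl wL]] := hankel_weights; first by lia.
pose th := slope L l; pose W i0 i := w i * (th i - th i0).
pose G := (\prod_i0 \det (hankel th (W i0) k)) * \det (hankel th w k).
have ltkm : (k <= m)%N by lia.
(* Moments for [W i0] combine two consecutive moments for [w], which costs one order of
   vanishing. *)
have WE (f : 'I_m -> K) i0 t : \sum_i W i0 i * f i * th i ^+ t =
    \sum_i w i * f i * th i ^+ t.+1 - th i0 * \sum_i w i * f i * th i ^+ t.
  rewrite mulr_sumr -sumrB; apply: eq_bigr => i _.
  by rewrite /W exprS; ring.
have dirG L' : L' \is 1.-homog -> forall e a b,
    (forall i0, dir_deg_le L' (e i0) (\det (hankel th (W i0) k))) ->
    dir_deg_le L' a (\det (hankel th w k)) ->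
    (\sum_i e i + a <= b)%N -> dir_deg_le L' b G.
  move=> L'1 e a b HW Hw leb; apply: dir_deg_leW leb _; apply: dir_deg_leM => //.
  exact: dir_deg_le_prod.
exists (G ^+ q); split.
- apply/expf_neq0/mulf_neq0; last first.
    apply/(@hankel_neq0 _ _ _ _ _ (widen_ord ltkm)) => //.
    by move=> i i' /(congr1 val)/= /val_inj.
  apply/prodf_neq0 => i0 _.
  have lekm : (k <= m.-1)%N by lia.
  apply/(@hankel_neq0 _ _ _ _ _ (fun p => lift i0 (widen_ord lekm p))) => //.
    by move=> p p' /lift_inj/(congr1 val)/= /val_inj.
  move=> p; rewrite mulf_neq0 // subr_eq0 (inj_eq slope_inj) eq_sym.
  exact: neq_lift.
- apply: dhomogMn; rewrite mulSn addnC; apply: dhomogM; last exact: dhomog_hankel.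
  suff: \prod_i \det (hankel th (W i) k) \is (#|'I_m| * k).-homog by rewrite card_ord.
  by apply: dhomog_prod_const => i; apply: dhomog_hankel.
- apply/dir_deg_le0; apply: (@dir_deg_le_exp _ _ _ 0 q) => //.
  apply: (dirG l l1 (fun=> 0%N) 0%N); last by rewrite big1.
    move=> i0; apply: hankel_deg0 => // t ltt.
    by rewrite WE !wl ?mulr0 ?subrr //; lia.
  by apply: hankel_deg0 => // t ltt; apply: wl; lia.
(* Along ['X_i] the cone with vertex i contributes 0, the other m - 1 cones and [hankel th w k] one
   each. Along [L] the m cones contribute one each and the last factor 0. Both totals are m. *)
- move=> i; apply: (@dir_deg_leW _ _ _ (m * q)) => //; apply: dir_deg_le_exp; first exact: dhomogXU.
  apply: (dirG 'X_i (dhomogXU _ i) (fun i0 => (i0 != i) : nat) 1%N) => [i0||].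
  + case: eqVneq => [->|_]; last exact: hankel_deg1_var.
    by apply: hankel_deg0_var; rewrite /W subrr mulr0.
  + exact: hankel_deg1_var.
  rewrite (bigD1 i) //= eqxx add0n.
  under eq_bigr => i0 -> do [].
  by rewrite sum1_card cardC1 card_ord; lia.
- apply: (@dir_deg_leW _ _ _ (m * q)) => //; apply: dir_deg_le_exp => //.
  apply: (dirG L L1 (fun=> 1%N) 0%N) => [i0||].
  + apply: hankel_deg1 => // t ltt.
    by rewrite WE !wL ?mulr0 ?subrr //; lia.
  + by apply: hankel_deg0 => // t ltt; apply: wL; lia.
  by rewrite sum1_card card_ord addn0.
Qed.

End ApolarForm.

(** * Perturbation to special linear forms *)

Lemma gen_ideal_mem (R : comPzRingType) (gs : seq R) g : g \in gs -> g \in gen_ideal gs.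
Proof.
move=> g_gs; have ltg : (index g gs < size gs)%N by rewrite index_mem.
apply/gen_idealP; exists (fun i => (i == index g gs)%:R).
rewrite (bigD1 (Ordinal ltg)) //= eqxx mul1r nth_index // big1 ?addr0 // => i.
by rewrite -val_eqE /= => /negPf->; rewrite mul0r.
Qed.

Lemma contract_gen_ideal (K : fieldType) (n : nat) (gs : seq {mpoly K[n]}) f F :
  (forall g, g \in gs -> contract g F = 0) -> f \in gen_ideal gs ->
  contract f F = 0.
Proof.
move=> gsF /gen_idealP[h ->]; rewrite contract_sum big1 // => i _.
by rewrite contractM gsF ?contract0r ?mem_nth.
Qed.

Section CharacteristicZero.
Variables (K : fieldType) (charK0 : [pchar K] =i pred0).

Lemma natr_inj : injective (fun k : nat => k%:R : K).
Proof.
move=> i j; wlog leij : i j / (i <= j)%N => [th|] /= e.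
  by case/orP: (leq_total i j) => /th; [apply | move/(_ (esym e))].
have /eqP : (j - i)%:R = 0 :> K by rewrite natrB // e subrr.
by rewrite (pcharf0P K).1 // subn_eq0 => leji; apply/eqP; rewrite eqn_leq leij.
Qed.

Lemma poly_nonroot (p : {poly K}) : p != 0 -> exists e, p.[e] != 0.
Proof.
move=> p_neq0; pose rs : seq K := [seq i%:R | i <- iota 0 (size p)].
have [/allP rs0|/allPn[e _ pe]] := boolP (all (root p) rs); last by exists e.
have rs_uniq : uniq rs by rewrite (map_inj_uniq natr_inj) iota_uniq.
have := max_poly_roots p_neq0 (introT allP rs0) rs_uniq.
by rewrite size_map size_iota ltnn.
Qed.

(** The contraction pairing is diagonal on monomials of equal degree; the factorials are nonzero in
    characteristic zero, so its values determine a form. *)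
Lemma contract_mono_mcoeff0 (n : nat) (F : {mpoly K[n]}) m :
  (contract 'X_[m] F)@_0%MM = F@_m *+ \prod_i (m i)`!.
Proof.
rewrite contractX mcoeff_mderivm addm0; congr (_ *+ _).
by apply: eq_bigr => i _; rewrite ffactnn.
Qed.

Section Perturbation.
Variables (n d j : nat) (L : {mpoly K[n]}).
Hypotheses (d_gt0 : (0 < d)%N) (L_neq0 : forall i, L@_U_(i) != 0).
Hypothesis apolar_exists : forall l : {mpoly K[n]}, l \is 1.-homog ->
  (forall i, l@_U_(i) != 0) -> injective (slope L l) ->
  exists F, apolar_form d L l j.+1 F.

(* A special [l] is handled by perturbation: along the line [l + e l'], the
   linear form is generic for almost all [e], and surjectivity of the
   multiplication by [l] persists for almost all [e]. *)
Lemma not_surjective l : l \is 1.-homog ->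
  ~ (forall f, f \is j.+1.-homog -> exists2 g, g \is j.-homog &
      f - l * g \in gen_ideal (power_gens d L)).
Proof.
move=> l1 surj; set I := gen_ideal _ in surj.
pose T := 'X_{1..n < j.+2}.
(* The slopes of [L] relative to [l'] are 1/(i + 1), pairwise distinct, so [l'] itself is
   generic. *)
pose l' : {mpoly K[n]} := \sum_i ((val i).+1%:R * L@_U_(i)) *: 'X_i.
have l'1 : l' \is 1.-homog.
  by apply: rpred_sum => i _; apply/dhomogZ/dhomogXU.
have l'E i : l'@_U_(i) = (val i).+1%:R * L@_U_(i).
  rewrite raddf_sum /= -[RHS](sum_mcoeffXU i (fun k => (val k).+1%:R * L@_U_(k))).
  by apply: eq_bigr => k _; rewrite mcoeffZ !mcoeffXU eq_sym.
(* Preimages of the monomials of degree j + 1 under multiplication by [l]; the monomials of lower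
   degree in [T] get the default 0. *)
have /boolp.choice[g gP] (mu : T) : exists g, g \is j.-homog /\
    (if mdeg mu == j.+1 then 'X_[mu] - l * g \in I else g == 0).
  case: (eqVneq (mdeg mu)) => [mu_j|_]; last by exists 0; rewrite rpred0.
  by have [|f f1 f2] := surj 'X_[mu]; [rewrite dhomogX; apply/eqP | exists f].
pose B : 'M[K]_#|{: T}| :=
  \matrix_(p, q) (l' * g (enum_val p))@_(enum_val q : T).
(* For monomials of degree j + 1, the rows of 1 + e B represent multiples of l + e l' modulo [I], so
   surjectivity persists where [Q] does not vanish. *)
pose Q : {poly K} := \det (1%:M + 'X *: map_mx polyC B).
have QE e : Q.[e] = \det (1%:M + e *: B).
  rewrite -[LHS]/(horner_eval e Q) -det_map_mx; congr (\det _).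
  apply/matrixP => p q; rewrite !mxE rmorphD rmorphM rmorph_nat /=.
  by rewrite /horner_eval hornerX hornerC.
have Q_neq0 : Q != 0.
  by apply/eqP => Q0; have := QE 0; rewrite Q0 horner0 scale0r addr0 det1 => /esym/eqP; rewrite oner_eq0.
pose Q1 i : {poly K} := (l@_U_(i))%:P + (l'@_U_(i)) *: 'X.
pose Q2 i k : {poly K} := (L@_U_(i)) *: Q1 k - (L@_U_(k)) *: Q1 i.
have Q1E i e : (Q1 i).[e] = (l + e *: l')@_U_(i).
  by rewrite /Q1 !hornerE mcoeffD mcoeffZ mulrC.
have Q1_coef i : (Q1 i)`_1 = (val i).+1%:R * L@_U_(i).
  by rewrite /Q1 coefD coefC coefZ coefX add0r mulr1 l'E.
have Q1_neq0 i : Q1 i != 0.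
  apply/eqP => Q1i; have := Q1_coef i; rewrite Q1i coef0 => /esym/eqP.
  by rewrite mulf_eq0 (negPf (L_neq0 i)) orbF (pcharf0P K).1.
have Q2_neq0 i k : i != k -> Q2 i k != 0.
  apply: contra_neq => Q2ik; have : (Q2 i k)`_1 = 0 by rewrite Q2ik coef0.
  rewrite /Q2 coefB !coefZ !Q1_coef => /eqP.
  rewrite mulrCA [X in _ - X]mulrCA [X in _ - _ * X]mulrC -mulrBl mulf_eq0.
  rewrite mulf_eq0 !(negPf (L_neq0 _)) /= orbF subr_eq0 => /eqP/natr_inj[].
  by move/val_inj.
have [e] : exists e, (Q * ((\prod_i Q1 i) * \prod_(ik : 'I_n * 'I_n | ik.1 != ik.2) Q2 ik.1 ik.2)).[e] != 0.
  apply: poly_nonroot; rewrite !mulf_neq0 //; first by apply/prodf_neq0 => i _.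
  by apply/prodf_neq0 => -[i k] /=; apply: Q2_neq0.
rewrite !hornerM !mulf_eq0 !negb_or QE !horner_prod => /and3P[detB Q1e Q2e].
pose le := l + e *: l'.
have le_neq0 i : le@_U_(i) != 0.
  by rewrite -Q1E; move/prodf_neq0: Q1e; apply.
have le1 : le \is 1.-homog by rewrite rpredD // dhomogZ.
have [|F [F_neq0 Fj leF XF LF]] := apolar_exists le1 le_neq0.
  move=> i k; apply: contra_eq => ik; rewrite /slope eqr_div //.
  move/prodf_neq0: Q2e => /(_ (i, k) ik) /=.
  by rewrite /Q2 hornerD hornerN !hornerZ !Q1E subr_eq0.
have IF f : f \in I -> contract f F = 0.
  apply: contract_gen_ideal => h; rewrite mem_rcons inE => /predU1P[->|/mapP[i _ ->]].
    by rewrite -(prednK d_gt0); apply: LF.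
  by rewrite -(prednK d_gt0); apply: XF.
pose phi : 'cV[K]_#|{: T}| := \col_p (contract 'X_[enum_val p : T] F)@_0%MM.
(* Since [F] is killed by [I] and by l + e l', its pairing with a monomial mu of degree j + 1 is -e
   times its pairing with l' g(mu). The other rows are zero. *)
have phi0 : (1%:M + e *: B) *m phi = 0.
  apply/colP => p; rewrite mulmxDl mul1mx -scalemxAl !mxE; set mu := enum_val p.
  have [g1 g2] := gP mu; set S := \sum_q _.
  have -> : S = (contract (l' * g mu) F)@_0%MM.
    rewrite (@contract_widen _ _ j.+2); last first.
      have lg : l' * g mu \is j.+1.-homog by rewrite -add1n dhomogM.
      rewrite msizeE; apply/bigmax_leqP_seq => m /(dhomog_mf lg) /= -> //.
    rewrite raddf_sum /= (reindex_onto enum_val enum_rank) => [|q _]; last exact: enum_rankK.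
    under [RHS]eq_bigl => q do rewrite enum_valK eqxx.
    by apply: eq_bigr => q _; rewrite !mxE mcoeffZ contractX.
  have H : contract (l * g mu) F + e *: contract (l' * g mu) F = 0.
    by rewrite -contractZ scalerAl -contractD -mulrDl mulrC contractM leF contract0r.
  move: g2; case: ifP => [_ /IF|mu_j /eqP gmu0].
    rewrite contractD -scaleN1r contractZ scaleN1r => /eqP; rewrite subr_eq0 => /eqP->.
    by rewrite -mcoeffZ -mcoeffD H mcoeff0.
  rewrite gmu0 mulr0 contract0 mcoeff0 mulr0 addr0 contract_mono_mcoeff0.
  by rewrite (dhomog_nemf_coeff Fj) ?mul0rn // mu_j.
have {}phi0 : phi = 0.
  have U : 1%:M + e *: B \in unitmx by rewrite unitmxE unitfE.
  by rewrite -(mulKmx U phi) phi0 mulmx0.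
case/eqP: F_neq0; apply/mpolyP => m; rewrite mcoeff0.
have [m_j|/(dhomog_nemf_coeff Fj)//] := eqVneq (mdeg m) j.+1.
have ltm : (mdeg m < j.+2)%N by rewrite m_j.
move/colP/(_ (enum_rank (BMultinom ltm))): phi0.
rewrite !mxE enum_rankK contract_mono_mcoeff0 -mulr_natr => /eqP.
rewrite mulf_eq0 ((pcharf0P K).1 charK0) => /orP[/eqP//|].
by rewrite eqn0Ngt prodn_gt0 // => i; rewrite fact_gt0.
Qed.

End Perturbation.
End CharacteristicZero.

(** * Strong Lefschetz property of the box algebra *)

Section BoxIdeal.
Variables (K : fieldType) (n d : nat).
Implicit Types (f g : {mpoly K[n]}) (m : 'X_{1..n}).

(* The monomial ideal generated by the [d]-th powers of the variables. *)
Definition in_box_ideal f := forall m, (forall i, m i < d)%N -> f@_m = 0.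

Lemma in_box_idealD f g :
  in_box_ideal f -> in_box_ideal g -> in_box_ideal (f + g).
Proof. by move=> Jf Jg m md; rewrite mcoeffD Jf ?Jg ?addr0. Qed.

Lemma in_box_idealZ c f : in_box_ideal f -> in_box_ideal (c *: f).
Proof. by move=> Jf m md; rewrite mcoeffZ Jf ?mulr0. Qed.

Lemma in_box_idealB f g :
  in_box_ideal f -> in_box_ideal g -> in_box_ideal (f - g).
Proof. by move=> Jf Jg m md; rewrite mcoeffB Jf ?Jg ?subr0. Qed.

Lemma in_box_idealM f g : in_box_ideal g -> in_box_ideal (f * g).
Proof.
move=> Jg m md; rewrite mcoeffM big1 // => -[k1 k2] /= /eqP mE.
rewrite Jg ?mulr0 // => i; apply: leq_ltn_trans (md i).
by move/mnmP/(_ i): mE => ->; rewrite mnmDE leq_addl.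
Qed.

Lemma mcoeff_XU_deriv i f m : ('X_i * f^`M(i))@_m = f@_m *+ m i.
Proof.
rewrite {1}(mpolyE f) [in RHS](mpolyE f) (raddf_sum (mderiv i)) mulr_sumr !raddf_sum.
rewrite -sumrMnl; apply: eq_bigr => m' _ /=.
rewrite mderivZ mderivX -!scalerAr -mpolyXD !mcoeffZ !mcoeffX.
case: (eqVneq (m' i) 0%N) => [m'i|m'i].
  by rewrite m'i mul0r mulr0; case: eqP => [<-|_]; rewrite ?m'i ?mulr0n ?mulr0 ?mul0rn.
have -> : (U_(i) + (m' - U_(i)))%MM = m'.
  by apply/mnmP => k; rewrite mnmDE mnmBE mnm1E; case: eqP => [<-|_] /=; lia.
case: eqP => [->|_]; last by rewrite !mulr0 mul0rn.
by rewrite !mulr1 mulr_natr.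
Qed.

Lemma euler_formula k f : f \is k.-homog ->
  \sum_i 'X_i * f^`M(i) = k%:R *: f.
Proof.
move=> fk; apply/mpolyP => m; rewrite raddf_sum mcoeffZ /=.
under eq_bigr => i _ do rewrite mcoeff_XU_deriv.
rewrite sumrMnr -mdegE mulr_natl.
by have [->//|mk] := eqVneq (mdeg m) k; rewrite (dhomog_nemf_coeff fk mk) !mul0rn.
Qed.

Section StrongLefschetz.
Variable L : {mpoly K[n]}.
Hypotheses (L1 : L \is 1.-homog) (L_neq0 : forall i, L@_U_(i) != 0).
Hypothesis d_gt0 : (0 < d)%N.

(* Together with the multiplication by [L] this operator spans a copy of sl2
   acting on the quotient by the box ideal. *)
Definition lowering f := \sum_i (L@_U_(i))^-1 *:
  (d.-1%:R *: f^`M(i) - 'X_i * f^`M(i)^`M(i)).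

(** In the i-th summand the coefficient at [m] has a factor d - 1 - m_i, which vanishes exactly when
    m + U_i leaves the box. *)
Lemma lowering_box f : in_box_ideal f -> in_box_ideal (lowering f).
Proof.
move=> Jf m md; rewrite raddf_sum big1 // => i _ /=.
rewrite mcoeffZ mcoeffB mcoeffZ mcoeff_XU_deriv mcoeff_deriv mulr_natl -mulrnBr.
  have [->|ne] := eqVneq (m i) d.-1; first by rewrite subnn mulr0n mulr0.
  rewrite Jf ?mul0rn ?mulr0 // => k; rewrite mnmDE mnm1E.
  by have := md k; case: eqP => [<-|_]; have := md i; lia.
by have := md i; lia.
Qed.

Lemma dhomog_mderiv k f i : f \is k.+1.-homog -> f^`M(i) \is k.-homog.
Proof.
move=> fk; apply/dhomogP => m; rewrite mcoeff_msupp mcoeff_deriv => fm.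
apply/eqP; apply: contraNT fm => mk.
by rewrite (dhomog_nemf_coeff fk) ?mul0rn //= mdegD mdeg1 addn1 eqSS.
Qed.

Lemma mderiv_deg0 f i : f \is 0.-homog -> f^`M(i) = 0.
Proof.
move=> f0; apply/mpolyP => m; rewrite mcoeff_deriv (dhomog_nemf_coeff f0) ?mul0rn ?mcoeff0 //.
by rewrite /= mdegD mdeg1 addn1.
Qed.

Lemma lowering_deg0 f : f \is 0.-homog -> lowering f = 0.
Proof.
move=> f0; rewrite /lowering big1 // => i _.
by rewrite mderiv_deg0 // mderiv0 mulr0 scaler0 subr0 scaler0.
Qed.

Lemma dhomog_lowering k f : f \is k.+1.-homog -> lowering f \is k.-homog.
Proof.
move=> fk; apply: rpred_sum => i _; apply/dhomogZ/rpredB.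
  exact/dhomogZ/dhomog_mderiv.
case: k fk => [|k] fk.
  by rewrite (@mderiv_deg0 f^`M(i)) ?mulr0 ?rpred0 // dhomog_mderiv.
by rewrite -add1n; apply: dhomogM; [exact: dhomogXU | do 2!apply: dhomog_mderiv].
Qed.

Lemma mderiv_linear i : L^`M(i) = (L@_U_(i))%:MP.
Proof.
rewrite {1}(linear_formE L1) raddf_sum (bigD1 i) //= big1 => [|k ki].
  by rewrite addr0 mderivZ mderivXU eqxx -mul_mpolyC mulr1.
by rewrite mderivZ mderivXU (negPf ki) mpolyC0 scaler0.
Qed.

(** The sl2 commutator: the reciprocals in [lowering] cancel the coefficients of [L], and Euler's
    formula turns the remaining sum into a scalar weight. *)
Lemma lowering_linearM k f : f \is k.-homog ->
  lowering (L * f) = L * lowering f + ((n * d.-1)%:R - k.*2%:R) *: f.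
Proof.
move=> fk.
have -> : ((n * d.-1)%:R - k.*2%:R) *: f =
    \sum_i (d.-1%:R *: f - 2%:R *: ('X_i * f^`M(i))).
  rewrite sumrB sumr_const card_ord -scaler_sumr (euler_formula fk).
  by rewrite scalerBl scalerA -natrM -mul2n -scaler_nat scalerA -natrM.
rewrite /lowering mulr_sumr -big_split /=; apply: eq_bigr => i _.
rewrite !(mderivM, mderivD, mderiv_linear, mderivC).
rewrite -[in RHS]scalerAr -[X in _ = _ + X](scalerK (L_neq0 i)) -scalerDr; congr (_ *: _).
by rewrite -!mul_mpolyC; ring.
Qed.

(** The scalar is the sum of the weights n(d - 1) - 2(k + s) for s = 0, ..., t; the bound keeps the
    truncated subtractions exact. *)
Lemma lowering_expM k t f : f \is k.-homog -> (t.+1 + k.*2 <= (n * d.-1).+1)%N ->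
  lowering (L ^+ t.+1 * f) = L ^+ t.+1 * lowering f +
    (t.+1 * (n * d.-1 - k.*2 - t))%:R *: (L ^+ t * f).
Proof.
move=> fk; elim: t => [|t IH] lekt.
  by rewrite !expr1 (lowering_linearM fk) expr0 mul1r mul1n subn0 natrB //; lia.
rewrite exprS -mulrA (@lowering_linearM (t.+1 + k)); last first.
  by apply: dhomogM => //; have := dhomogMn t.+1 L1; rewrite mul1n.
rewrite IH ?mulrDr; last by lia.
rewrite -scalerAr !mulrA -!exprS -addrA -scalerDl; congr (_ + _ *: _).
have [c cE] : exists c, (n * d.-1 = c + (k.*2 + t.+1))%N.
  by exists (n * d.-1 - (k.*2 + t.+1))%N; lia.
have -> : (n * d.-1 - k.*2 - t = c.+1)%N by lia.
have -> : (n * d.-1 - k.*2 - t.+1 = c)%N by lia.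
by rewrite cE -!mul2n !(natrD, natrM, mulrSr); ring.
Qed.

(** Modulo the box ideal, let L^(t+1) kill f. Applying [lowering] and multiplying by L shows that
    L^(t+2) kills [lowering f], which has smaller degree and so is zero; then a nonzero multiple of
    L^t f is zero. *)
Lemma strong_lefschetz k t f : [pchar K] =i pred0 -> f \is k.-homog ->
  (t + k.*2 <= n * d.-1)%N -> in_box_ideal (L ^+ t * f) -> in_box_ideal f.
Proof.
move=> charK0; elim: k t f => [|k IHk] t f fk.
  elim: t => [|t IHt] lekt; first by rewrite mul1r.
  move=> /lowering_box; rewrite (lowering_expM fk) ?(leq_trans lekt) // lowering_deg0 // mulr0 add0r.
  move=> /(in_box_idealZ ((t.+1 * (n * d.-1 - 0.*2 - t))%:R^-1)).
  rewrite scalerK; first by apply: IHt; lia.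
  by rewrite (pcharf0P K).1 // muln_eq0 /=; lia.
elim: t => [|t IHt] lekt Jt; first by rewrite mul1r in Jt.
have := lowering_box Jt; rewrite (lowering_expM fk) ?(leq_trans lekt) //.
set c := _%:R; move=> J2.
have Jlow : in_box_ideal (lowering f).
  apply: (IHk t.+2); [exact: dhomog_lowering | lia |].
  have := in_box_idealB (in_box_idealM L J2) (in_box_idealZ c Jt).
  by rewrite mulrDr -scalerAr !mulrA -!exprS addrK.
have := in_box_idealZ c^-1 (in_box_idealB J2 (in_box_idealM (L ^+ t.+1) Jlow)).
rewrite addrAC subrr add0r scalerK; first by apply: IHt; lia.
by rewrite (pcharf0P K).1 // muln_eq0 /=; lia.
Qed.

End StrongLefschetz.
End BoxIdeal.

(** * Injectivity against surjectivity *)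

Section RankCount.
Variables (K : fieldType) (n d : nat).
Implicit Types (f g h p L l : {mpoly K[n]}).

Definition box_set k := [set s : {ffun 'I_n -> 'I_d} | (\sum_i s i)%N == k].
Definition box_mnm (s : {ffun 'I_n -> 'I_d}) : 'X_{1..n} := [multinom (s i : nat) | i < n].

Lemma box_mnm_inj : injective box_mnm.
Proof.
by move=> s t /mnmP st; apply/ffunP => i; apply/val_inj; have := st i; rewrite !mnmE.
Qed.

Definition box_val k (q : 'I_#|box_set k|) := box_mnm (enum_val q).

Lemma mdeg_box_val k q : mdeg (@box_val k q) = k.
Proof.
have := enum_valP q; rewrite inE => /eqP sk; rewrite -[RHS]sk mdegE.
by apply: eq_bigr => i _; rewrite mnmE.
Qed.

Lemma box_val_inj k : injective (@box_val k).
Proof. by move=> q q' /box_mnm_inj/enum_val_inj. Qed.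

Lemma box_val_lt k q i : (@box_val k q i < d)%N.
Proof. by rewrite mnmE. Qed.

Lemma box_val_surj k (m : 'X_{1..n}) : mdeg m = k -> (forall i, m i < d)%N ->
  exists q, @box_val k q = m.
Proof.
move=> mk md; pose s := [ffun i => Ordinal (md i)].
have sk : s \in box_set k.
  by rewrite inE -mk mdegE; apply/eqP/eq_bigr => i _; rewrite ffunE.
exists (enum_rank_in sk s); apply/mnmP => i.
by rewrite /box_val enum_rankK_in // mnmE ffunE.
Qed.

Definition box_row k f : 'rV[K]_#|box_set k| := \row_q f@_(box_val q).
Definition box_poly k (v : 'rV[K]_#|box_set k|) : {mpoly K[n]} :=
  \sum_q v 0 q *: 'X_[box_val q].
Definition box_mul p k k' : 'M[K]_(#|box_set k|, #|box_set k'|) :=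
  \matrix_(q, q') (p * 'X_[box_val q])@_(box_val q').

Lemma box_rowD k f g : box_row k (f + g) = box_row k f + box_row k g.
Proof. by apply/rowP => q; rewrite !mxE mcoeffD. Qed.

Lemma box_rowB k f g : box_row k (f - g) = box_row k f - box_row k g.
Proof. by apply/rowP => q; rewrite !mxE mcoeffB. Qed.

Lemma box_row_mul p k k' v : box_row k' (p * box_poly v) = v *m box_mul p k k'.
Proof.
apply/rowP => q'; rewrite !mxE mulr_sumr raddf_sum; apply: eq_bigr => q _ /=.
by rewrite -scalerAr mcoeffZ !mxE.
Qed.

Lemma box_polyK k : cancel (@box_poly k) (box_row k).
Proof.
move=> v; apply/rowP => q; rewrite mxE raddf_sum (bigD1 q) //= big1 => [|q' ne].
  by rewrite addr0 mcoeffZ mcoeffX eqxx mulr1.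
by rewrite mcoeffZ mcoeffX (inj_eq (@box_val_inj k)) (negPf ne) mulr0.
Qed.

Lemma dhomog_box_poly k v : @box_poly k v \is k.-homog.
Proof.
apply: rpred_sum => q _; apply: dhomogZ; rewrite dhomogX.
exact/eqP/mdeg_box_val.
Qed.

Lemma box_row_eq0 k f : in_box_ideal d f -> box_row k f = 0.
Proof.
move=> Jf; apply/rowP => q; rewrite !mxE Jf // => i; exact: box_val_lt.
Qed.

Lemma box_row0_in k f : f \is k.-homog -> box_row k f = 0 -> in_box_ideal d f.
Proof.
move=> fk f0 m md; have [mk|/(dhomog_nemf_coeff fk)//] := eqVneq (mdeg m) k.
have [q <-] := box_val_surj mk md.
by move/rowP/(_ q): f0; rewrite !mxE.
Qed.

Lemma box_row_eq k f g : in_box_ideal d (f - g) -> box_row k f = box_row k g.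
Proof. by move/(box_row_eq0 k) => fg0; rewrite -(subrK g f) box_rowD fg0 add0r. Qed.

Lemma sub_box_polyK k f : f \is k.-homog -> in_box_ideal d (f - box_poly (box_row k f)).
Proof.
move=> fk; apply: (@box_row0_in k); first by rewrite rpredB // dhomog_box_poly.
by rewrite box_rowB box_polyK subrr.
Qed.

Section Quotient.
Variable L : {mpoly K[n]}.
Hypothesis L1 : L \is 1.-homog.
Local Notation I := (gen_ideal (power_gens d L)).

Lemma in_box_gen f : in_box_ideal d f -> f \in I.
Proof.
move=> Jf; rewrite (mpolyE f) big_seq; apply: rpred_sum => m; rewrite mcoeff_msupp => fm.
have [i ledm] : exists i, (d <= m i)%N.
  apply/existsP; apply: contraR fm; rewrite negb_exists => /forallP md.
  by apply/eqP/Jf => i; rewrite ltnNge.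
have -> : m = ((m - U_(i) *+ d) + U_(i) *+ d)%MM.
  by apply/mnmP => k; rewrite mnmDE mnmBE mulmnE mnm1E; case: eqP => [<-|_]; lia.
rewrite mpolyXD scalerAl; apply/gen_idealMr/gen_ideal_mem.
rewrite -mpolyXn mem_rcons inE; apply/orP; right.
by apply/mapP; exists i; rewrite ?mem_enum.
Qed.

Lemma exp_gen g : L ^+ d * g \in I.
Proof. by rewrite mulrC; apply/gen_idealMr/gen_ideal_mem; rewrite mem_rcons mem_head. Qed.

(** The multiplier of [L ^+ d] can be cut down to its component of degree [k], since its other
    components contribute in other degrees. *)
Lemma gen_ideal_homog k f : f \is (k + d).-homog -> f \in I ->
  exists2 h, h \is k.-homog & in_box_ideal d (f - L ^+ d * h).
Proof.
move=> fk /gen_idealP[h fE]; pose H := h (size [seq ('X_i : {mpoly K[n]}) ^+ d | i <- enum 'I_n]).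
have JH : in_box_ideal d (f - L ^+ d * H).
  rewrite fE size_rcons big_ord_recr /= nth_rcons ltnn eqxx mulrC addrK.
  elim/big_ind: _ => [m _|f1 f2|i _]; [by rewrite mcoeff0 | exact: in_box_idealD |].
  apply: in_box_idealM; rewrite nth_rcons ltn_ord.
  have /mapP[k' _ ->] := mem_nth 0 (ltn_ord i) => m md.
  rewrite mpolyXn mcoeffX; case: eqP => // mE.
  by have := md k'; rewrite -mE mulmnE mnm1E eqxx mul1n ltnn.
exists (pihomog mdeg k H); first exact: pihomogP.
move=> m md; have [mk|mk] := eqVneq (mdeg m) (k + d)%N; last first.
  apply: (@dhomog_nemf_coeff _ _ mdeg (k + d)%N _ _ _ mk); apply: rpredB => //.
  have Ld : L ^+ d \is d.-homog by have := dhomogMn d L1; rewrite mul1n.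
  by rewrite addnC dhomogM // pihomogP.
rewrite -[RHS](JH m md) !mcoeffB; congr (_ - _).
have leK : (msize H <= maxn (msize H) k.+1)%N by apply: leq_maxl.
have ltk : (k < maxn (msize H) k.+1)%N by apply: leq_maxr.
rewrite [in RHS](pihomog_partitionE leK) (bigD1 (Ordinal ltk)) //= mulrDr mcoeffD.
rewrite [L ^+ d * \sum_(_ < _ | _) _]mulr_sumr [X in _ + X](raddf_sum (mcoeff m)) [X in _ + X]big1 ?addr0 // => e ne.
have Ld : L ^+ d \is d.-homog by have := dhomogMn d L1; rewrite mul1n.
apply: (@dhomog_nemf_coeff _ _ mdeg (d + e)%N); first by rewrite dhomogM // pihomogP.
by rewrite /= mk addnC eqn_add2l eq_sym.
Qed.

(* The kernel of (u, v) |-> l u + L^d v on the quotient by the box ideal is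
   spanned by the Koszul relations (L^d h, - l h); the count then forces
   surjectivity. *)
Lemma surjective_of_injective l a : [pchar K] =i pred0 -> (0 < d)%N ->
  (forall i, L@_U_(i) != 0) -> l \is 1.-homog ->
  (d + a.+1.*2 <= n * d.-1)%N ->
  (#|box_set (a + d).+1| + #|box_set a| <= #|box_set (a + d)| + #|box_set a.+1|)%N ->
  (forall u, u \is (a + d).-homog -> l * u \in I -> u \in I) ->
  forall f, f \is (a + d).+1.-homog ->
    exists2 g, g \is (a + d).-homog & f - l * g \in I.
Proof.
move=> charK0 d_gt0 L_neq0 l1 le_d card_le inj_l f fj.
have Ld : L ^+ d \is d.-homog by have := dhomogMn d L1; rewrite mul1n.
pose Phi := col_mx (box_mul l (a + d)%N (a + d).+1) (box_mul (L ^+ d) a.+1 (a + d).+1).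
pose Psi := row_mx (box_mul (L ^+ d) a (a + d)%N) (- box_mul l a a.+1).
have PhiE u v : row_mx u v *m Phi =
    box_row (a + d).+1 (l * box_poly u + L ^+ d * box_poly v).
  by rewrite mul_row_col box_rowD !box_row_mul.
have lu u : l * @box_poly (a + d)%N u \is (a + d).+1.-homog.
  by rewrite -add1n dhomogM // dhomog_box_poly.
have Lv v : L ^+ d * @box_poly a.+1 v \is (a + d).+1.-homog.
  by rewrite -addSn addnC dhomogM // dhomog_box_poly.
have ker_le : (kermx Phi <= Psi)%MS.
  apply/rV_subP => w /sub_kermxP; rewrite -[w]hsubmxK.
  move: (lsubmx w) (rsubmx w) => u v {w}; rewrite PhiE => /box_row0_in.
  move=> /(_ (rpredD (lu u) (Lv v))) Juv.
  have [|h hk Jh] := @gen_ideal_homog a (box_poly u) (dhomog_box_poly u).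
    apply: inj_l; first exact: dhomog_box_poly.
    by rewrite -[_ * _](addrK (L ^+ d * box_poly v)) rpredB ?exp_gen // in_box_gen.
  (* L^d (l h + v) lies in the box ideal, and strong Lefschetz in degree a + 1, available by [le_d],
     cancels L^d. *)
  have Jv : in_box_ideal d (l * h + box_poly v).
    apply: (@strong_lefschetz _ _ _ L L1 L_neq0 d_gt0 a.+1 d) => //.
      by rewrite rpredD ?dhomog_box_poly // -add1n dhomogM.
    have := in_box_idealB Juv (in_box_idealM l Jh).
    by congr in_box_ideal; ring.
  have Jz := sub_box_polyK hk; set z := box_row a h in Jz.
  apply/submxP; exists z; rewrite mul_mx_row mulmxN -!box_row_mul.
  congr row_mx.
    rewrite -[LHS]box_polyK; apply: box_row_eq.
    have := in_box_idealD Jh (in_box_idealM (L ^+ d) Jz).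
    by congr in_box_ideal; ring.
  rewrite -[LHS]box_polyK; apply/eqP; rewrite -addr_eq0 -box_rowD; apply/eqP/box_row_eq0.
  have := in_box_idealB Jv (in_box_idealM l Jz).
  by congr in_box_ideal; ring.
(* The kernel has rank at most the number of rows of [Psi]; by [card_le] the rank of [Phi] then
   reaches its number of columns. *)
have full : row_full Phi.
  rewrite /row_full eqn_leq rank_leq_col /=.
  have arith (A B C D r s : nat) : (A + B <= C + D)%N -> (s <= B)%N ->
    (r <= C + D)%N -> (C + D - r <= s)%N -> (A <= r)%N by lia.
  apply: arith card_le (rank_leq_row Psi) (rank_leq_row Phi) _.
  by rewrite -mxrank_ker; apply: mxrankS.
have /submxP[w fw] : (box_row (a + d).+1 f <= Phi)%MS by apply: submx_full.
exists (box_poly (lsubmx w)); first exact: dhomog_box_poly.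
rewrite -[X in X \in _](subrK (L ^+ d * box_poly (rsubmx w))) rpredD ?exp_gen //.
apply/in_box_gen/(@box_row0_in (a + d).+1); first by apply: rpredB (Lv _); apply: rpredB (lu _).
by rewrite !box_rowB -addrA -opprD -box_rowD -PhiE hsubmxK fw subrr.
Qed.

End Quotient.
End RankCount.

(** * Concavity of the coefficients *)

Section Window.
Variable h : int -> nat.

Definition window x k := (\sum_(i < k) h (x - i%:Z))%N.

Lemma window_add x a b : window x (a + b) = (window x a + window (x - a%:Z) b)%N.
Proof.
rewrite /window big_split_ord; congr (_ + _)%N; apply: eq_bigr => i _ /=.
by congr h; lia.
Qed.

Lemma window1 x : window x 1 = h x.
Proof. by rewrite /window big_ord1 subr0. Qed.

Lemma window_le x k M : (forall y, h y <= M)%N -> (window x k <= k * M)%N.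
Proof.
move=> hM; rewrite -[in leqRHS](card_ord k) -sum_nat_const.
exact: leq_sum.
Qed.

End Window.

Section BoxCount.
Variable d : nat.
Hypothesis d_gt0 : (0 < d)%N.

(* The coefficient of z^k in ((1 - z^d)/(1 - z))^n, extended by zero to k < 0. *)
Fixpoint box_count n (k : int) : nat :=
  if n is n'.+1 then window (box_count n') k d else (k == 0).
Local Notation W := box_count.

Lemma box_count_neg n k : (k < 0)%R -> W n k = 0%N.
Proof.
elim: n k => [|n IH] k k_lt0 /=; first by case: eqP => // k0; lia.
by rewrite /window big1 // => i _; apply: IH; lia.
Qed.

(** Both sides are the window of length d + 1 at [x], with one end term split off. *)
Lemma box_count_diff n (x : int) : (W n.+1 x + W n (x - d%:Z) = W n x + W n.+1 (x - 1))%N.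
Proof. by rewrite /= -!(window1 (W n)) -!window_add addnC. Qed.

Lemma box_count_sym n (x : int) : W n ((n * d.-1)%:Z - x) = W n x.
Proof.
elim: n x => [|n IH] x /=; first by rewrite mul0n sub0r oppr_eq0.
rewrite /window (reindex_inj rev_ord_inj); apply: eq_bigr => i _ /=.
rewrite -[RHS]IH; congr W; rewrite mulSn; have := ltn_ord i; lia.
Qed.

(** Induction on [n]: when a window moves by one, a term enters and a term leaves, so the gap
    between the two products splits into [E1] and [E2], which hold term by term. Wider pairs follow
    by unit steps. *)
Lemma box_count_logconcave n (p q r t : int) : p + q = r + t -> (r <= p)%R -> (r <= q)%R ->
  (W n r * W n t <= W n p * W n q)%N.
Proof.
elim: n p q r t => [|n IH] p q r t pq rp rq.
  by rewrite /=; do 4!case: eqP => ?; lia.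
have step (x y : int) : (x <= y)%R -> (W n.+1 (x - 1) * W n.+1 (y + 1) <= W n.+1 x * W n.+1 y)%N.
  move=> xy.
  have Ex := box_count_diff n x; have Ey := box_count_diff n (y + 1).
  have E1 : (W n.+1 (x - 1) * W n (y + 1) <= W n.+1 y * W n x)%N.
    rewrite /= /window !big_distrl /=; apply: leq_sum => i _.
    by rewrite [leqRHS]mulnC; apply: IH; lia.
  have E2 : (W n.+1 y * W n (x - d%:Z) <= W n.+1 (x - 1) * W n (y + 1 - d%:Z))%N.
    rewrite /= /window !big_distrl /=; apply: leq_sum => i _.
    by rewrite mulnC; apply: IH; have := ltn_ord i; lia.
  rewrite addrK in Ey; move: E1 E2 Ex Ey.
  move: (W n.+1 x) (W n.+1 (x - 1)) (W n.+1 y) (W n.+1 (y + 1)) => X X' Y Y'.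
  move: (W n (y + 1)) (W n x) (W n (x - d%:Z)) (W n (y + 1 - d%:Z)) => u v s w.
  move=> E1 E2 /(congr1 (muln Y)) + /(congr1 (muln X')).
  rewrite !mulnDr; lia.
wlog pq' : p q pq rp rq / (p <= q)%R => [th|].
  case: (lerP p q) => [|/ltW] qp; first exact: th.
  by rewrite [leqRHS]mulnC; apply: th => //; rewrite addrC.
have [s rE] : exists s : nat, r = p - s%:Z by exists (absz (p - r)); lia.
have -> : t = q + s%:Z by lia.
rewrite {}rE {r pq rp rq}.
elim: s => [|s IHs]; first by rewrite subr0 addr0.
apply: leq_trans IHs; have := step (p - s%:Z) (q + s%:Z).
have -> : p - s%:Z - 1 = p - s.+1%:Z by lia.
have -> : q + s%:Z + 1 = q + s.+1%:Z by lia.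
by apply; lia.
Qed.

(** By symmetry each square is a product over two mirror points, and the two pairs are nested. *)
Lemma box_count_unimodal n (x y : int) :
  (`|2 * x - (n * d.-1)%:Z| <= `|2 * y - (n * d.-1)%:Z|)%R -> (W n y <= W n x)%N.
Proof.
move=> xy; rewrite -leq_sqr !expnS !expn0 !muln1.
rewrite -{2}(box_count_sym n y) -{2}(box_count_sym n x).
have [yc|cy] := lerP (2 * y) (n * d.-1)%:Z; last rewrite mulnC.
all: by apply: box_count_logconcave; lia.
Qed.

(** The windows at [p] and at its mirror image have equal sums; their tops are at most d apart, so
    together they cover the central window. *)
Lemma box_count_half n (p q : int) : (`|2 * p - (n.+1 * d.-1)%:Z| <= d%:Z)%R ->
  (W n.+1 q <= 2 * W n.+1 p)%N.
Proof.
set c := (n.+1 * d.-1)%N => pd.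
wlog pc : p pd / (2 * p <= c%:Z)%R => [th|].
  have [pc|cp] := lerP (2 * p) c%:Z; first exact: th.
  by rewrite -(box_count_sym n.+1 p) -/c; apply: th; lia.
pose p0 : int := (c./2)%:Z.
have p0E : (2 * p0 <= c%:Z < 2 * p0 + 2)%R by rewrite /p0; lia.
apply: (@leq_trans (W n.+1 p0)).
  by apply: box_count_unimodal; rewrite -/c; lia.
rewrite mul2n -addnn -{1}(box_count_sym n.+1 p) -/c /=.
have [a aE] : exists a : nat, p0 = p + a%:Z by exists (absz (p0 - p)%R); lia.
have [b bE] : exists b : nat, c%:Z - p = p0 + b%:Z by exists (absz (c%:Z - p - p0)%R); lia.
have [e1 dE1] : exists e, d = (a + e)%N by exists (d - a)%N; lia.
have [e2 dE2] : exists e, d = (b + a + e)%N by exists (d - (b + a))%N; lia.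
rewrite {1 3}dE1 {1}dE2 [window _ p0 _]window_add [window _ (c%:Z - p) _]window_add window_add.
have -> : c%:Z - p - b%:Z = p0 by lia.
have -> : p0 - a%:Z = p by lia.
rewrite [(a + e1)%N]addnC [window _ p (e1 + a)]window_add; lia.
Qed.

(* With A, B, C the three values below, log-concavity gives A^2 C <= B^3, and
   2 A <= 3 B; hence A^2 (A + C - 2 B) <= A^3 + B^3 - 2 A^2 B
   = (A - B)(A^2 - A B - B^2) <= 0. *)
Lemma box_count_concave n (j : int) D : 2 * j + D%:Z = (n.+2 * d.-1 + d)%:Z -> (12 * D <= d)%N ->
  (W n.+2 j + W n.+2 (j + D%:Z + d%:Z) <= 2 * W n.+2 (j + D%:Z))%N.
Proof.
move=> jE Dd; set A := W n.+2 j; set B := W n.+2 (j + D%:Z); set C := W _ (_ + d%:Z).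
have BA : (B <= A)%N by apply: box_count_unimodal; lia.
pose E := W n.+2 (j + 2%:Z * D%:Z); pose F := W n.+2 (j + 3%:Z * D%:Z).
have CF : (C <= F)%N by apply: box_count_unimodal; lia.
have AE : (A * E <= B * B)%N by apply: box_count_logconcave; lia.
have AF : (A * F <= B * E)%N by apply: box_count_logconcave; lia.
(* The constant 12 comes from here: A - B is at most D M, with M the central count in one variable
   fewer, and d M <= 4 A because the lower half of the window of A stays within d/2 of the
   centre. *)
have AB : (2 * A <= 3 * B)%N.
  set c := (n.+1 * d.-1)%N; pose M := W n.+1 (c./2)%:Z.
  have WM y : (W n.+1 y <= M)%N by apply: box_count_unimodal; rewrite -/c; lia.
  have cE : (n.+2 * d.-1 = c + d.-1)%N by rewrite /c !mulSn; lia.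
  have [e dE] : exists e, d = (D + e)%N by exists (d - D)%N; lia.
  have AE1 : (A <= B + D * M)%N.
    have -> : A = (window (W n.+1) j e + window (W n.+1) (j - e%:Z) D)%N.
      by rewrite -window_add addnC -dE.
    have -> : B = (window (W n.+1) (j + D%:Z) D + window (W n.+1) (j + D%:Z - D%:Z) e)%N.
      by rewrite -window_add -dE.
    by rewrite addrK; have := window_le (j - e%:Z) D WM; lia.
  have dM : (d * M <= 4 * A)%N.
    have [f fE] : exists f, d = (d./2 + f)%N by exists (d - d./2)%N; lia.
    have : (f * M <= 2 * window (W n.+1) (j - (d./2)%:Z) f)%N.
      rewrite -[in leqLHS](card_ord f) -sum_nat_const big_distrr /=.
      apply: leq_sum => i _; apply: box_count_half; rewrite -/c.
      by have := ltn_ord i; lia.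
    have : (window (W n.+1) (j - (d./2)%:Z) f <= A)%N.
      have -> : A = (window (W n.+1) j d./2 + window (W n.+1) (j - (d./2)%:Z) f)%N.
        by rewrite -window_add -fE.
      exact: leq_addl.
    by nia.
  by nia.
have CB : (C <= B)%N by apply: box_count_unimodal; lia.
have [A0|A_gt0] := posnP A; first by lia.
suff : (A * A * (A + C) <= A * A * (2 * B))%N by rewrite leq_pmul2l // muln_gt0 A_gt0.
have H1 : (A * A * C <= B * B * B)%N.
  apply: (@leq_trans (A * (B * E))); first by rewrite -mulnA leq_mul2l (leq_trans _ AF) ?orbT // leq_mul2l CF orbT.
  by rewrite mulnCA -mulnA leq_mul2l AE orbT.
have [x AE2] : exists x, A = (B + x)%N by exists (A - B)%N; lia.
have xA : (x * A <= B * B)%N by rewrite AE2; nia.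
have H2 : (x * (x * A) <= x * (B * B))%N by rewrite leq_mul2l xA orbT.
have H3 : (A * A * A + B * B * B + x * (B * B) = A * A * (2 * B) + x * (x * A))%N.
  by rewrite AE2; ring.
by rewrite mulnDr; move: H1 H2 H3; lia.
Qed.

Lemma card_box_set n (k : nat) : #|box_set n d k| = W n k%:Z.
Proof.
pose P : {poly int} := \sum_(i < d) 'X^i.
have cW : (P ^+ n)`_k = (W n k%:Z)%:R.
  elim: n k => [|n IH] k; first by rewrite expr0 coef1; case: k.
  rewrite exprSr mulr_sumr coef_sum /= /window natr_sum; apply: eq_bigr => i _.
  rewrite coefMXn; case: ltnP => ki; first by rewrite box_count_neg //; lia.
  by rewrite IH; congr (_%:R); congr W; lia.
suff cB : (P ^+ n)`_k = #|box_set n d k|%:R.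
  by have := etrans (esym cB) cW; lia.
have -> : P ^+ n = \sum_(s : {ffun 'I_n -> 'I_d}) 'X^(\sum_i s i)%N.
  rewrite -[n in P ^+ n]card_ord -prodr_const bigA_distr_bigA /=.
  by apply: eq_bigr => s _; rewrite prodrXr.
rewrite coef_sum -sum1_card natr_sum [RHS]big_mkcond; apply: eq_bigr => s _ /=.
by rewrite coefXn inE eq_sym; case: eqP.
Qed.

(** By [box_count_diff] a first difference in n + 3 variables is a difference over distance d in n +
    2 variables; reflection carries a + 1 and a + 1 - d to j + D and j + D + d. *)
Lemma card_box_set_concave n a D : (2 * (a + d).+1 + D = n.+2 * d.-1 + d)%N ->
  (12 * D <= d)%N ->
  (#|box_set n.+3 d (a + d).+1| + #|box_set n.+3 d a| <=
   #|box_set n.+3 d (a + d)| + #|box_set n.+3 d a.+1|)%N.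
Proof.
move=> aE Dd; rewrite !card_box_set; set j : int := (a + d).+1%:Z.
have := @box_count_concave n j D; rewrite -[W _ (j + _ + _)]box_count_sym -[W _ (j + _)]box_count_sym.
have := box_count_diff n.+2 j; have := box_count_diff n.+2 a.+1%:Z.
have -> : a.+1%:Z - 1 = a%:Z by lia.
have -> : j - 1 = (a + d)%N%:Z by lia.
have -> : j - d%:Z = a.+1%:Z by lia.
have -> : (n.+2 * d.-1)%:Z - (j + D%:Z) = a.+1%:Z by lia.
have -> : (n.+2 * d.-1)%:Z - (j + D%:Z + d%:Z) = a.+1%:Z - d%:Z by lia.
move=> H1 H2 H3; have := H3 _ Dd; lia.
Qed.

End BoxCount.

(** * Choice of the degree and conclusion *)

Lemma apolar_degree_exists (K : fieldType) (n d : nat) (L : {mpoly K[n.+3]}) :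
  (24 <= n)%N -> (n.+3 ^ 3 < d)%N -> L \is 1.-homog ->
  exists a D, [/\ (2 * (a + d).+1 + D = n.+2 * d.-1 + d)%N, (12 * D <= d)%N &
    forall l : {mpoly K[n.+3]}, l \is 1.-homog -> (forall i, l@_U_(i) != 0) ->
      injective (slope L l) -> exists F, apolar_form d L l (a + d).+1 F].
Proof.
move=> n_ge d_ge L1; set m := n.+3 in d_ge *.
have d_ge' : (m * (m * m) < d)%N by move: d_ge; rewrite !expnS expn0 muln1.
have d_gt : (m < d)%N by nia.
suff [j [D [jE Dd F]]] : exists j D, [/\ (2 * j + D = n.+2 * d.-1 + d)%N, (12 * D <= d)%N &
    forall l : {mpoly K[m]}, l \is 1.-homog -> (forall i, l@_U_(i) != 0) ->
      injective (slope L l) -> exists F, apolar_form d L l j F].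
  exists (j - d.+1)%N, D; have -> : ((j - d.+1 + d).+1 = j)%N by nia.
  by split.
have mE := odd_double_half m; case: odd mE => mE; last first.
  exists (m./2 * d.-1)%N, 1%N; split=> [||l l1 l_neq0 slope_inj].
  - have -> : (2 * (m./2 * d.-1) = m * d.-1)%N by rewrite mulnA mul2n -[in RHS]mE.
    by rewrite /m mulSn; lia.
  - by lia.
  by apply: apolar_form_even => //; lia.
have dE := divn_eq d.-1 m; set q := (d.-1 %/ m)%N in dE; set r := (d.-1 %% m)%N in dE.
have r_lt : (r < m)%N by rewrite ltn_mod.
have q_ge : (m * m <= q)%N by rewrite leq_divRL //; lia.
(* Here 2 j = (m^2 - 1) q and d - 1 = m q + r, so D = m (d - 1) + 1 - 2 j. *)
exists (m.+1 * m./2 * q)%N, (q + m * r + 1)%N; split=> [||l l1 l_neq0 slope_inj].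
- have -> : (2 * (m.+1 * m./2 * q) = m.+1 * n.+2 * q)%N.
    by have -> : n.+2 = (2 * m./2)%N by [lia]; nia.
  have -> : (n.+2 * d.-1 + d = m * d.-1 + 1)%N by rewrite /m mulSn; lia.
  by rewrite dE /m; ring.
(* From m r + 1 <= m^2 <= q and 24 <= m follows 12 D <= 24 q <= m q < d. *)
- have : (24 * q <= q * m)%N by rewrite mulnC leq_mul2l; lia.
  have : (m * r + m <= m * m)%N by rewrite addnC -mulnS leq_mul2l r_lt orbT.
  by lia.
by apply: apolar_form_odd => //; lia.
Qed.

Theorem theorem6p9 (K : fieldType) (charK0 : [pchar K] =i pred0) :
  exists N : nat, forall n : nat, (N <= n)%N ->
  exists D : nat, forall d : nat, (D <= d)%N ->
  for_general_linear_form (fun L : {mpoly K[n.+1]} =>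
    ~ WLP (quot_grading (gs := power_gens d L))).
Proof.
(* Destructing shifts [n] by two, leaving 24 <= n and n + 3 variables. *)
exists 26 => -[|[|n]] // n_ge; exists (n.+3 ^ 3).+1 => d d_ge.
(* The open set where no coefficient of [L] vanishes; the sum of the variables lies in it. *)
exists (fun L => forall i, (L : {mpoly K[n.+3]})@_U_(i) != 0); split.
- exists (fun p => p = \prod_i 'X_i) => L; split=> [L_neq0|[_ -> pL] i].
    exists (\prod_i 'X_i) => //; rewrite rmorph_prod /=.
    by apply/prodf_neq0 => i _; rewrite mevalXU.
  by move: pL; rewrite rmorph_prod /= => /prodf_neq0/(_ i isT); rewrite mevalXU.
- have s1 : (\sum_i 'X_i : {mpoly K[n.+3]}) \is 1.-homog.
    by apply: rpred_sum => i _; apply: dhomogXU.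
  exists (DHomog s1) => i /=; rewrite raddf_sum /= (bigD1 i) //= big1 => [|k ki].
    by rewrite addr0 mcoeffXU eqxx oner_neq0.
  by rewrite mcoeffXU (negPf ki).
case=> L L1 /= L_neq0 [_ [l l1 ->] maxrank].
have [a [D [aE Dd apolar]]] := apolar_degree_exists n_ge d_ge L1.
have d_gt0 : (0 < d)%N by lia.
apply: (not_surjective charK0 d_gt0 L_neq0 apolar l1).
have := maxrank (a + d).+1%:Z.
have -> : (a + d).+1%:Z - 1 = (a + d)%N%:Z by lia.
(* Either alternative of maximal rank gives surjectivity onto degree a + d + 1, which the apolar
   forms exclude. *)
case=> [inj|surj] f fj.
  apply: (surjective_of_injective L1 charK0 d_gt0 L_neq0 l1) => // [||u uj lu].
  - by rewrite mulSn; lia.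
  - exact: (card_box_set_concave d_gt0 aE Dd).
  rewrite -[u]subr0; apply/to_quot_eq/inj; [by exists u | by exists 0; rewrite /= ?rpred0 |].
  rewrite -[LHS]to_quotM -[RHS]to_quotM; apply/to_quot_eq.
  by rewrite mulr0 subr0.
have [|_ [g gj ->]] := surj (to_quot _ f); first by exists f.
rewrite -[LHS]to_quotM => lg; exists g => //; apply/to_quot_eq.
by rewrite lg.
Qed.
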